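(* Let $(\mathbb{K},|\cdot|)$ be a non-Archimedean valued field of characteristic zero, let $X$ be an ultrametric normed space over $\mathbb{K}$, let $Y$ be a $\mathbb{Q}$-vector space, let $m\ge 0$ be an integer and let $r>0$ be a real number. Assume that $f:X\to Y$ satisfies \[ \Delta_h^{m+1}f(x)=0\quad\text{for all } x\in X \text{ and all } h\in B_X(r), \] and let \[ \phi(r,m)=r\left(\prod_{k=2}^{m+1}\max\{|1/t| : t=1,2,\dots,k\}\right)^{-1}. \] Then for every $x_0\in X$ there exist a constant $A_{0,x_0}\in Y$ and, for $k=1,2,\dots,m$, $k$-additive symmetric maps \[ A^{k,x_0}:\underbrace{B_X(\phi(r,m))\times\cdots\times B_X(\phi(r,m))}_{k\text{ times}}\to Y \] such that \[ f(x_0+z)=A_{0,x_0}+\sum_{k=1}^mA_{k,x_0}(z)\quad\text{for all } z\in B_X(\phi(r,m)), \] where $A_{k,x_0}(z)=A^{k,x_0}(z,z,\dots,z)$ is the diagonalization of $A^{k,x_0}$, $k=1,\dots,m$.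
   Context: $B_X(\rho)=\{x\in X:\|x\|\le\rho\}$ denotes the closed ball; since the norm is ultrametric ($\|x+y\|\le\max\{\|x\|,\|y\|\}$), it is an additive subgroup of $X$. A map of $k$ variables on an additive group is $k$-additive if it is additive in each variable separately. In $|1/t|$, the integer $t$ is regarded as an element of $\mathbb{K}$ (which contains $\mathbb{Q}$, having characteristic zero), and $|\cdot|$ is the absolute value of $\mathbb{K}$. An empty product equals $1$. The difference operators are $\Delta_hf(x)=f(x+h)-f(x)$ and $\Delta_h^{n+1}f=\Delta_h(\Delta_h^nf)$, so $\Delta_h^{m+1}f(x)=\sum_{k=0}^{m+1}\binom{m+1}{k}(-1)^{m+1-k}f(x+kh)$. *)

(* Defs.v *)
From HB Require Import structures.
From mathcomp Require Import all_boot all_order all_algebra.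
From mathcomp Require Import perm reals.
From mathcomp Require Import interval_inference.

Set Implicit Arguments.
Unset Strict Implicit.
Unset Printing Implicit Defensive.

Import Order.TTheory GRing.Theory Num.Theory.
Local Open Scope ring_scope.

(* The normed types of MathComp are Archimedean: normrMn imposes
   `|x *+ n| = `|x| *+ n. Hence the two records below. *)

(* The trivial absolute value is not excluded. *)
Record nonarchAbs (R : realType) (K : fieldType) := NonarchAbs {
  absv :> K -> R;
  absv_ge0 : forall a, 0 <= absv a;
  absv_eq0 : forall a, (absv a == 0) = (a == 0);
  absvM : forall a b, absv (a * b) = absv a * absv b;
  absvD : forall a b, absv (a + b) <= Num.max (absv a) (absv b)
}.

Record ultraNorm (R : realType) (K : fieldType) (v : nonarchAbs R K)
    (X : lmodType K) := UltraNorm {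
  unorm :> X -> R;
  unorm_ge0 : forall x, 0 <= unorm x;
  unorm_eq0 : forall x, (unorm x == 0) = (x == 0);
  unormZ : forall a x, unorm (a *: x) = v a * unorm x;
  unormD : forall x y, unorm (x + y) <= Num.max (unorm x) (unorm y)
}.

Section AbsNormTheory.
Context (R : realType) (K : fieldType) (v : nonarchAbs R K).
Context (X : lmodType K) (N : ultraNorm v X).

Lemma absv1 : v 1 = 1.
Proof.
have v1 : v 1 != 0 by rewrite absv_eq0 oner_eq0.
by apply: (mulfI v1); rewrite -absvM !mulr1.
Qed.

Lemma absvN1 : v (-1) = 1.
Proof.
apply/eqP; rewrite -(@eqrXn2 _ 2%N) ?absv_ge0 ?ler01 // expr1n expr2 -absvM.
by rewrite mulrNN mulr1 absv1.
Qed.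

Lemma unorm0 : N 0 = 0.
Proof. by apply/eqP; rewrite unorm_eq0. Qed.

Lemma unormN x : N (- x) = N x.
Proof. by rewrite -scaleN1r unormZ absvN1 mul1r. Qed.

End AbsNormTheory.

Definition cball (R : realType) (K : fieldType) (v : nonarchAbs R K)
    (X : lmodType K) (N : ultraNorm v X) (rho : R) : {pred X} :=
  [pred x | N x <= rho].

Section BallGroup.
Context (R : realType) (K : fieldType) (v : nonarchAbs R K).
Context (X : lmodType K) (N : ultraNorm v X) (rho : {nonneg R}).

Lemma cball_zmod_closed : zmod_closed (cball N rho%:num).
Proof.
split=> [|x y]; rewrite !inE ?unorm0 // => Nx Ny.
by apply: le_trans (unormD N x (- y)) _; rewrite unormN ge_max Nx.
Qed.

HB.instance Definition _ :=
  GRing.isZmodClosed.Build X (cball N rho%:num) cball_zmod_closed.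

Record cball_group := CballGroup {
  cball_val :> X;
  cball_valP : cball_val \in cball N rho%:num
}.

HB.instance Definition _ := [isSub for cball_val].
HB.instance Definition _ := [Choice of cball_group by <:].
HB.instance Definition _ := [SubChoice_isSubZmodule of cball_group by <:].

End BallGroup.

Definition fdiff (X Y : zmodType) (h : X) (f : X -> Y) : X -> Y :=
  fun x => f (x + h) - f x.

Section MultiAdditive.
Context (V W : zmodType) (k : nat).
Implicit Types (A : {ffun 'I_k -> V} -> W) (x : {ffun 'I_k -> V}).

Definition set_var x (i : 'I_k) (u : V) : {ffun 'I_k -> V} :=
  [ffun j => if j == i then u else x j].

Definition kadditive A : Prop :=
  forall i x, {morph (fun u => A (set_var x i u)) : u w / u + w}.

Definition ksymmetric A : Prop :=
  forall (s : 'S_k) x, A [ffun i => x (s i)] = A x.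

Definition diagonal A (z : V) : W := A [ffun=> z].

End MultiAdditive.

Section Radius.
Context (R : realType) (K : fieldType) (v : nonarchAbs R K).

(* The default value 0 of the maximum plays no role: v is nonnegative and the
   range 1 <= t <= k is nonempty for k >= 2. *)
Definition phi (r : R) (m : nat) : R :=
  r * (\prod_(2 <= k < m.+2) \big[Num.max/0]_(1 <= t < k.+1) v (1 / t%:R))^-1.

Lemma phi_ge0 r m : 0 < r -> 0 <= phi r m.
Proof.
move=> r0; rewrite mulr_ge0 ?invr_ge0 ?(ltW r0) //.
apply: prodr_ge0 => k _; elim/big_ind: _ => [|a b a0 b0|t _] //.
- by rewrite le_max a0.
- exact: absv_ge0.
Qed.

End Radius.

(* Main.v *)
Require Import Defs.
From mathcomp Require Import all_boot all_order all_algebra.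
From mathcomp Require Import perm boolp reals zify.
From mathcomp Require Import interval_inference.

(** Every point [h] of the ball of radius [phi r m] satisfies [h / t \in B(r)]
    for [1 <= t <= m + 1], which is what Djokovic's argument needs to pass from
    iterated differences to mixed ones: given [h_1, ..., h_(m+1)], the sequence
    [u j := Delta_{(1 - j/1) h_1} ... Delta_{(1 - j/(m+1)) h_(m+1)} f x] is
    zero for [1 <= j <= m + 1] (one increment is null), while its [m+1]-st
    difference is a signed sum of terms [Delta_k^(m+1) f] with [k] in [B(r)],
    hence zero; therefore [u 0 = 0].  Once all the mixed differences of order
    [m + 1] vanish on the subgroup [B(phi r m)], those of order [m] do not
    depend on the base point, so they are symmetric and additive in each
    increment; subtracting their diagonal divided by [m!] lowers the degree. *)

Set Implicit Arguments.
Unset Strict Implicit.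
Unset Printing Implicit Defensive.

Import Order.TTheory GRing.Theory Num.Theory.
Local Open Scope ring_scope.

(** * Calculus of iterated differences *)

Section Differences.
Context (V W : zmodType).
Implicit Types (f g : V -> W) (h x : V) (hs : seq V).

Definition fdiffs hs f : V -> W := foldr (@fdiff V W) f hs.

Lemma fdiffC h k f : fdiff h (fdiff k f) = fdiff k (fdiff h f).
Proof.
apply/funext => x; rewrite /fdiff !opprB [x + h + k]addrAC.
by rewrite [LHS]addrACA [RHS]addrACA [- f (x + h) + _]addrC.
Qed.

Lemma fdiffB h f g : fdiff h (fun x => f x - g x) =
  fun x => fdiff h f x - fdiff h g x.
Proof.
apply/funext => x; rewrite /fdiff !opprB.
by rewrite [LHS]addrACA [RHS]addrACA [- g (x + h) + _]addrC.
Qed.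

Lemma fdiffD h f g : fdiff h (fun x => f x + g x) =
  fun x => fdiff h f x + fdiff h g x.
Proof. by apply/funext => x; rewrite /fdiff opprD addrACA. Qed.

Lemma fdiff0 h : fdiff h (fun=> 0 : W) = fun=> 0.
Proof. by apply/funext => x; rewrite /fdiff subrr. Qed.

Lemma iter_fdiffB n h f g : iter n (fdiff h) (fun x => f x - g x) =
  fun x => iter n (fdiff h) f x - iter n (fdiff h) g x.
Proof. by elim: n => //= n ->; rewrite fdiffB. Qed.

Lemma fdiffs_fdiff h hs f : fdiffs hs (fdiff h f) = fdiffs (h :: hs) f.
Proof. by elim: hs => //= k hs ->; rewrite fdiffC. Qed.

Lemma fdiffsB hs f g : fdiffs hs (fun x => f x - g x) =
  fun x => fdiffs hs f x - fdiffs hs g x.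
Proof. by elim: hs => //= k hs ->; rewrite fdiffB. Qed.

Lemma fdiffsD hs f g : fdiffs hs (fun x => f x + g x) =
  fun x => fdiffs hs f x + fdiffs hs g x.
Proof. by elim: hs => //= k hs ->; rewrite fdiffD. Qed.

Lemma fdiffs0 hs : fdiffs hs (fun=> 0 : W) = fun=> 0.
Proof. by elim: hs => //= k hs ->; rewrite fdiff0. Qed.

Lemma fdiffs_mem0 hs f x : 0 \in hs -> fdiffs hs f x = 0.
Proof.
elim: hs x => //= h hs IHhs x; rewrite inE => /predU1P[<-|hs0].
  by rewrite /fdiff addr0 subrr.
by rewrite /fdiff !IHhs // subrr.
Qed.

Lemma perm_fdiffs hs hs' f : perm_eq hs hs' -> fdiffs hs f = fdiffs hs' f.
Proof.
elim: hs hs' => [|h hs IHhs] hs'; first by rewrite perm_sym => /perm_nilP ->.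
move=> hsP; have hhs' : h \in hs' by rewrite -(perm_mem hsP) mem_head.
have /permPr remP := perm_to_rem hhs'.
have : perm_eq hs (rem h hs') by rewrite -(perm_cons h) -remP.
(* It remains to commute [h] to the front of [hs']. *)
move=> /IHhs /= ->; elim: hs' hhs' {IHhs hsP remP} => //= k hs' IHhs'.
rewrite inE eq_sym; have [->//|_ /= hhs'] := eqVneq k h.
by rewrite -IHhs' //= fdiffC.
Qed.

End Differences.

(** * From iterated to mixed differences, along integer sequences *)

Section IntSequences.
Context (V W : zmodType).

Lemma iter_fdiff_line n (f : V -> W) x y (j : int) :
  iter n (fdiff 1) (fun i : int => f (x + y *~ i)) j =
  iter n (fdiff y) f (x + y *~ j).
Proof.
elim: n j => //= n IHn j.
by rewrite /fdiff !IHn mulrzDr addrA.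
Qed.

(** The [n]-th difference at 0 is a signed binomial combination of [u 0, ..., u n], in which [u 0]
    has coefficient [(-1)^n]. *)
Lemma iter_fdiff_head n (u : int -> W) :
  (forall j : nat, (1 <= j <= n)%N -> u j%:Z = 0) ->
  iter n (fdiff 1) u 0 = 0 -> u 0 = 0.
Proof.
elim: n u => // n IHn u u0; rewrite iterSr => Du0.
have : fdiff 1 u 0 = 0.
  apply: IHn => // j /andP[j1 jn]; rewrite /fdiff -PoszD addn1.
  by rewrite (u0 j.+1) // (u0 j) ?subrr // j1 ltnW.
by rewrite /fdiff add0r (u0 1%N) // sub0r => /eqP; rewrite oppr_eq0 => /eqP.
Qed.

(** Expanding the mixed difference leaves signed values of [f] along lines [x' + y' *~ j], where
    [y'] is the sum of [y] and some of the [p.2], hence lies in [S]. *)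
Lemma iter_fdiff_fdiffs_line n (S : zmodClosed V) (f : V -> W) :
  (forall x h, h \in S -> iter n (fdiff h) f x = 0) ->
  forall (s : seq (V * V)) x y, y \in S -> all [pred p | p.2 \in S] s ->
  iter n (fdiff 1) (fun j : int =>
    fdiffs [seq p.1 + p.2 *~ j | p <- s] f (x + y *~ j)) 0 = 0.
Proof.
move=> f0; elim=> [|[h k] s IHs] x y yS /=.
  by move=> _; rewrite iter_fdiff_line f0.
case/andP=> kS sS.
rewrite [X in iter n _ X](_ : _ = fun j : int =>
  fdiffs [seq p.1 + p.2 *~ j | p <- s] f (x + h + (y + k) *~ j) -
  fdiffs [seq p.1 + p.2 *~ j | p <- s] f (x + y *~ j)).
  by rewrite iter_fdiffB !IHs ?subrr // rpredD.
by apply/funext => j; rewrite /fdiff mulrzDl addrACA.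
Qed.

End IntSequences.

Lemma fdiffs_iter_fdiff0 (K : fieldType) (X : lmodType K) (Y : zmodType)
    (charK0 : [pchar K] =i pred0) (S : zmodClosed X) n (f : X -> Y) :
  (forall x h, h \in S -> iter n (fdiff h) f x = 0) ->
  forall hs x, size hs = n ->
  (forall h t, h \in hs -> (1 <= t <= n)%N -> t%:R^-1 *: h \in S) ->
  fdiffs hs f x = 0.
Proof.
move=> f0 hs x szhs hsS.
(* Indices start at 0: the increment of index [i] becomes [(1 - j / (i + 1)) h_i], which vanishes
   for [j = i + 1]. *)
pose k i : X := - (i.+1%:R^-1 *: hs`_i).
pose s := [seq (hs`_i, k i) | i <- iota 0 n].
(* The base point is fixed; its slope 0 only matches the form of the lemma on lines. *)
pose u (j : int) := fdiffs [seq p.1 + p.2 *~ j | p <- s] f (x + 0 *~ j).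
have <- : u 0 = fdiffs hs f x.
  rewrite /u mulr0z addr0 -map_comp; congr (fdiffs _ f x).
  rewrite -[RHS](mkseq_nth 0) szhs; apply: eq_map => i /=.
  by rewrite mulr0z addr0.
apply: (@iter_fdiff_head _ n) => [[//|j] /= jn|]; last first.
  apply: (iter_fdiff_fdiffs_line f0); rewrite ?rpred0 //.
  apply/allP => _ /mapP[i + ->] /=; rewrite mem_iota add0n => /= ltin.
  by rewrite rpredN hsS ?mem_nth ?szhs.
apply: fdiffs_mem0; apply/mapP; exists (hs`_j, k j).
  by apply: map_f; rewrite mem_iota.
rewrite /= /k mulNrz -pmulrn -scaler_nat scalerA divff ?scale1r ?subrr //.
by move/pcharf0P: charK0 => ->.
Qed.

(** * Polarization of symmetric multiadditive functions *)

Section Polarization.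
Context (V W : zmodType) (n : nat) (M : seq V -> W).
Hypothesis M_perm : forall l l', perm_eq l l' -> M l = M l'.
Hypothesis M_add : forall u w t, size t = n ->
  M (u + w :: t) = M (u :: t) + M (w :: t).

(** Each difference trades one shifted argument [a + z] for its increment, and the factorial counts
    the orders of doing so. The offsets [l] are arbitrary because they pick up increments during the
    induction; [t] collects the increments already traded. *)
Lemma fdiffs_shifted_diagonal hs l t x :
  size l = size hs -> (size hs + size t = n.+1)%N ->
  fdiffs hs (fun z => M ([seq a + z | a <- l] ++ t)) x =
  M (hs ++ t) *+ (size hs)`!.
Proof.
elim: hs l t x => [|h hs IHhs] l t x; first by case: l.
move=> /= szl szt; rewrite -[fdiff _ _ _]/(fdiffs (h :: hs) _ x) -fdiffs_fdiff.
(* Telescoping: the letters of [l2] pass from [_ + z + h] to [_ + z] one by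
   one, each step contributing one [h] to the arguments of [M]. *)
suff {l szl} step l1 l2 : (size l1 + size l2 = (size hs).+1)%N ->
    fdiffs hs (fun z =>
      M ([seq a + (z + h) | a <- l2] ++ [seq a + z | a <- l1] ++ t) -
      M ([seq a + z | a <- l2] ++ [seq a + z | a <- l1] ++ t)) x =
    M (h :: hs ++ t) *+ (size l2 * (size hs)`!).
  by rewrite factS -szl; apply: (step [::] l).
elim: l2 l1 => [|a l2 IHl2] l1 /=.
  move=> _; rewrite [X in fdiffs _ X](_ : _ = fun=> 0) ?fdiffs0 //.
  by apply/funext => z; rewrite subrr.
rewrite addnS => -[szl].
(* Additivity in the letter [a + (z + h) = h + (a + z)]: [first] carries the [h], and in [rest] the
   letter [a] has moved from [l2] to [l1]. *)
pose first z := M ([seq b + z | b <- [seq b + h | b <- l2] ++ l1] ++ h :: t).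
pose rest z :=
  M ([seq b + (z + h) | b <- l2] ++ [seq b + z | b <- a :: l1] ++ t) -
  M ([seq b + z | b <- l2] ++ [seq b + z | b <- a :: l1] ++ t).
rewrite [X in fdiffs _ X](_ : _ = fun z => first z + rest z); last first.
  apply/funext => z; rewrite /first /rest /= [RHS]addrA.
  have -> : a + (z + h) = h + (a + z) by rewrite addrA addrC.
  rewrite M_add; last first.
    by rewrite !size_cat !size_map addnA [X in (X + _)%N]addnC szl; case: szt.
  have mid c l : M (c :: l ++ [seq b + z | b <- l1] ++ t) =
                 M (l ++ c :: [seq b + z | b <- l1] ++ t).
    apply: M_perm; apply/seq.permP => p.
    by rewrite /= !count_cat /= ?count_cat; lia.
  congr (_ + _ - _); rewrite ?mid //.
  apply: M_perm; apply/seq.permP => p.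
  rewrite /= map_cat !count_cat /= count_cat -map_comp.
  rewrite (@eq_map _ _ (+%R^~ z \o +%R^~ h) (fun b => b + (z + h))) => [|b /=].
    by rewrite -addnA (addnCA (p h)).
  by rewrite -addrA [h + z]addrC.
rewrite fdiffsD IHl2 /=; last by rewrite addSn szl.
rewrite /first IHhs; last 2 first.
- by rewrite size_cat size_map addnC.
- by rewrite /= addnS.
rewrite mulSn mulrnDr; congr (_ *+ _ + _); apply: M_perm.
by apply/seq.permP => p; rewrite /= !count_cat /= ?count_cat; lia.
Qed.

End Polarization.

(** Since [t] does not depend on [u], additivity of a symmetric function of lists in the head
    becomes additivity in the variable [i]. *)
Lemma perm_codom_set_var (V : zmodType) k (x : {ffun 'I_k -> V}) i :
  exists2 t, size t = k.-1 & forall u, perm_eq (codom (set_var x i u)) (u :: t).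
Proof.
exists [seq x j | j <- rem i (enum 'I_k)] => [|u].
  by rewrite size_map size_rem ?mem_enum // -cardE card_ord.
have enumP := perm_to_rem (mem_enum 'I_k i).
rewrite /codom /image_mem (perm_trans (perm_map _ enumP)) //= ffunE eqxx.
suff /eq_in_map -> : {in rem i (enum 'I_k), set_var x i u =1 x} by [].
by move=> j; rewrite mem_rem_uniq ?enum_uniq // inE ffunE => /andP[/negPf ->].
Qed.

Lemma perm_codom_perm (V : eqType) k (x : {ffun 'I_k -> V}) (s : 'S_k) :
  perm_eq (codom [ffun i => x (s i)]) (codom x).
Proof.
rewrite /codom /image_mem (eq_map (g := x \o s)) => [|i]; last by rewrite ffunE.
rewrite map_comp perm_map // uniq_perm ?enum_uniq //.
  by rewrite map_inj_uniq ?enum_uniq //; apply: perm_inj.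
move=> i; rewrite mem_enum; apply/mapP; exists (s^-1%g i); rewrite ?mem_enum //.
by rewrite permKV.
Qed.

(** * Descent on the degree *)

Lemma fdiffs0_multiadditive (V : zmodType) (Y : lmodType rat) m (g : V -> Y) :
  (forall hs x, size hs = m.+1 -> fdiffs hs g x = 0) ->
  exists (A0 : Y) (A : forall k : nat, {ffun 'I_k -> V} -> Y),
    (forall k : nat, (1 <= k <= m)%N -> kadditive (A k) /\ ksymmetric (A k)) /\
    forall z, g z = A0 + \sum_(1 <= k < m.+1) diagonal (A k) z.
Proof.
elim: m g => [|m IHm] g g0.
  exists (g 0), (fun _ _ => 0); split=> [[|k] //|z].
  rewrite big_geq // addr0; apply/eqP; rewrite -subr_eq0.
  by rewrite -(g0 [:: z] 0) //= /fdiff add0r.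
(* The scalar cancels the factorial produced by polarization. *)
pose M l := m.+1`!%:R^-1 *: fdiffs l g 0.
have M_perm l l' : perm_eq l l' -> M l = M l'.
  by move=> ll'; rewrite /M (perm_fdiffs _ ll').
(* Moving the base point from 0 to [x] costs a difference of order [m.+2], which is zero. *)
have M_base l x : size l = m.+1 -> fdiffs l g x = fdiffs l g 0.
  move=> szl; apply/eqP; rewrite -subr_eq0.
  by rewrite -(g0 (x :: l) 0) /= ?szl // /fdiff add0r.
(* With [F = fdiffs t g], [F (u + w) - F 0 = (F (w + u) - F w) + (F w - F 0)], and the base point
   [w] can be moved to 0. *)
have M_add u w t : size t = m -> M (u + w :: t) = M (u :: t) + M (w :: t).
  move=> szt; rewrite /M -scalerDr; congr (_ *: _).
  rewrite -(M_base (u :: t) w) /= ?szt // /fdiff !add0r [w + u]addrC.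
  by rewrite addrA subrK.
(* The diagonal of [M], written with shifted zeros to fit the polarization lemma. *)
pose top z := M [seq a + z | a <- nseq m.+1 0].
have fdiffs_top hs x : size hs = m.+1 -> fdiffs hs top x = fdiffs hs g x.
  move=> szhs; rewrite (M_base hs x szhs).
  have := @fdiffs_shifted_diagonal V Y m M M_perm M_add hs (nseq m.+1 0) [::] x.
  rewrite size_nseq szhs addn0 cats0 => /(_ erefl erefl).
  under [X in fdiffs _ X]funext => z do rewrite cats0.
  rewrite /M -scaler_nat scalerA divff ?scale1r // => ->.
have [|A0 [A [Asym gE]]] := IHm (fun z => g z - top z).
  by move=> hs x szhs; rewrite fdiffsB fdiffs_top ?subrr.
exists A0, (fun k (x : {ffun 'I_k -> V}) =>
  if k == m.+1 then M (codom x) else A k x); split.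
  move=> k /andP[k1]; case: eqP => [-> _|/eqP km]; last first.
    by rewrite leq_eqVlt (negPf km) /= => km'; apply: Asym; rewrite k1.
  split=> [i x u w|s x]; last exact/M_perm/perm_codom_perm.
  have [t szt tP] := perm_codom_set_var x i.
  by rewrite !(M_perm _ _ (tP _)) M_add.
move=> z; rewrite big_nat_recr //= /diagonal eqxx addrA.
rewrite (eq_big_nat _ _ (F2 := fun k => diagonal (A k) z)) => [|k /andP[_ km]].
  have /all_pred1P codomE : all (pred1 z) (codom [ffun _ : 'I_m.+1 => z]).
    by apply/allP => _ /codomP[i ->]; rewrite ffunE /=.
  by rewrite codomE size_codom card_ord -gE /top map_nseq add0r subrK.
by rewrite ltn_eqF.
Qed.

(** * Estimate of the radius *)

Lemma absv_inv_le_prod (R : realType) (K : fieldType) (v : nonarchAbs R K) m t :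
  (1 <= t <= m.+1)%N ->
  v t%:R^-1 <=
    \prod_(2 <= k < m.+2) \big[Num.max/0]_(1 <= t < k.+1) v (1 / t%:R).
Proof.
pose c k := \big[Num.max/0]_(1 <= t < k.+1) v (1 / t%:R).
have c_ge k s : (1 <= s <= k)%N -> v s%:R^-1 <= c k.
  move=> sk; rewrite -div1r /c.
  apply: (le_bigmax_seq 0 s xpredT (fun t => v (1 / t%:R))) => //.
  by rewrite mem_index_iota.
(* The index 1 contributes [|1| = 1] to every maximum, so all factors are at least 1 and the product
   dominates each of them. *)
have c_ge1 k : (1 <= k)%N -> 1 <= c k.
  by move=> k1; rewrite (le_trans _ (c_ge k 1%N _)) // invr1 absv1.
have prod_ge1 n : 1 <= \prod_(2 <= k < n.+2) c k.
  elim: n => [|n IHn]; first by rewrite big_geq.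
  by rewrite big_nat_recr //= mulr_ege1 ?c_ge1.
rewrite -/c; elim: m => [|m IHm] /andP[t1].
  by case: t t1 => [|[|]] // _ _; rewrite big_geq // invr1 absv1.
rewrite big_nat_recr //= leq_eqVlt => /predU1P[->|tm].
  apply: le_trans (c_ge m.+2 m.+2 _) _; first by rewrite leqnn.
  by apply: ler_peMl; rewrite ?prod_ge1 // (le_trans ler01) ?c_ge1.
rewrite (le_trans (IHm _)) ?t1 // ler_peMr ?c_ge1 //.
exact: le_trans ler01 (prod_ge1 m).
Qed.

Lemma cball_phi_divn (R : realType) (K : fieldType) (v : nonarchAbs R K)
    (X : lmodType K) (N : ultraNorm v X) m (r : R) h t :
  0 < r -> h \in cball N (phi v r m) -> (1 <= t <= m.+1)%N ->
  t%:R^-1 *: h \in cball N r.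
Proof.
rewrite !inE unormZ => r_gt0 hphi tm.
have vt := absv_inv_le_prod v tm.
(* The case [t = 1] bounds the product below by 1, so it cancels against its inverse in [phi]. *)
have v1 := @absv_inv_le_prod _ _ v m 1%N isT.
rewrite (le_trans (ler_pM _ _ vt hphi)) ?absv_ge0 ?unorm_ge0 // /phi.
by rewrite mulrCA divff ?mulr1 // gt_eqF // (lt_le_trans _ v1) // invr1 absv1.
Qed.

Theorem theorem3p2 (R : realType) (K : fieldType) (v : nonarchAbs R K)
    (charK0 : [pchar K] =i pred0)
    (X : lmodType K) (N : ultraNorm v X) (Y : lmodType rat)
    (m : nat) (r : R) (r_gt0 : 0 < r) (f : X -> Y)
    (f_diff0 : forall x h : X, h \in cball N r ->
       iter m.+1 (fdiff h) f x = 0)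
    (B := cball_group N (NngNum (phi_ge0 v m r_gt0)))
    (x0 : X) :
  exists (A0 : Y) (A : forall k : nat, {ffun 'I_k -> B} -> Y),
    (forall k : nat, (1 <= k <= m)%N -> kadditive (A k) /\ ksymmetric (A k)) /\
    forall z : B,
      f (x0 + cball_val z) = A0 + \sum_(1 <= k < m.+1) diagonal (A k) z.
Proof.
apply: (@fdiffs0_multiadditive B Y m (fun z => f (x0 + cball_val z))).
move=> hs x szhs.
(* The hypothesis concerns differences on [X], the goal those on the ball group; they agree because
   [cball_val] is additive. *)
have fdiffs_val (l : seq B) (z : B) :
    fdiffs l (fun z : B => f (x0 + cball_val z)) z =
    fdiffs [seq cball_val h | h <- l] f (x0 + cball_val z).
  by elim: l z => //= h l IHl z; rewrite /fdiff !IHl addrA.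
rewrite fdiffs_val.
pose S := cball N (NngNum (ltW r_gt0))%:num.
apply: (fdiffs_iter_fdiff0 charK0 (S := S) f_diff0).
  by rewrite size_map.
move=> _ t /mapP[h _ ->]; apply: cball_phi_divn => //; exact: cball_valP.
Qed.
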